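(* Let $a<b$ be real numbers, let $N$ be a positive integer, set $h=\frac1N$, and suppose $b-a=Mh$ for some positive integer $M$. Put $\omega^N=\{1,\dots,M\}$ and $x_j=a+(j-\tfrac12)h$ for $j\in\omega^N$. For $j\in\omega^N$ let $$ s_{j}= \mathrm{p.v.}\!\int_{a}^{b} \frac{dy}{y-x_{j}} - \sum_{k\in\omega^{N}\setminus\{j\}}\frac{h}{x_{k}-x_{j}}\,. $$ Then for all $j\in\omega^{N}$ $$ |s_{j}| \le \frac{h^{2}}8 \left|\frac1{(x_{j}-a)^{2}}- \frac1{(b-x_{j})^{2}} \right| = \left|\tfrac{a+b}2 -x_{j}\right| (b-a) \left(\frac{h}{2(x_{j}-a)(b-x_{j})}\right)^{2}\,. $$
   Context: The notation $\mathrm{p.v.}\int_a^b$ denotes the Cauchy principal value integral, i.e. $\lim_{\varepsilon\to0+}\int_{\{y\in(a,b):\,|y-x_j|>\varepsilon\}}\frac{dy}{y-x_j}$. The points $x_1,\dots,x_M$ are the midpoints of the $M$ subintervals of length $h$ into which $(a,b)$ is divided, so $x_1=a+\tfrac h2$ and $x_M=b-\tfrac h2$. *)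

(* Defs.v *)
From mathcomp Require Import all_boot all_order all_algebra.
From mathcomp Require Import all_classical all_reals all_analysis.
Import Order.TTheory GRing.Theory Num.Theory.
Import numFieldNormedType.Exports.

Set Implicit Arguments.
Unset Strict Implicit.
Unset Printing Implicit Defensive.

Local Open Scope classical_set_scope.
Local Open Scope ring_scope.

Section PrincipalValue.
Variable R : realType.
Implicit Types (f : R -> R) (a b c eps : R).

Definition truncated_integral f a b c eps : R :=
  \int[lebesgue_measure]_(y in [set y : R | a < y < b /\ eps < `|y - c|]) f y.

(* [lim] is total, so [pv_integral] is only meaningful together with
   [has_pv_integral]. *)
Definition has_pv_integral f a b c : Prop :=
  cvg (truncated_integral f a b c eps @[eps --> 0^'+]).

Definition pv_integral f a b c : R :=
  lim (truncated_integral f a b c eps @[eps --> 0^'+]).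

End PrincipalValue.

Definition midpoint (R : realType) (a h : R) (j : nat) : R :=
  a + (j%:R - 1 / 2) * h.

Definition pv_error (R : realType) (a b h : R) (M j : nat) : R :=
  let x := midpoint a h in
  pv_integral (fun y => 1 / (y - x j)) a b (x j)
  - \sum_(1 <= k < M.+1 | k != j) h / (x k - x j).

(* Main.v *)
(* With m = M - j and n = j - 1, the principal value is ln (m + 1/2) - ln (n + 1/2)
   and the midpoint sum is H_m - H_n, so s_j = g m - g n with
   g i = ln (i + 1/2) - H_i, H_i the harmonic numbers.  The mean value theorem for
   ln (1 + u) - ln (1 - u) - 2 u at u = 1 / (2 (i + 1)) gives
   0 <= g (i + 1) - g i <= (1/8) (1 / (i + 1/2)^2 - 1 / (i + 3/2)^2),
   and these bounds telescope. *)
Require Import Defs.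
From mathcomp Require Import all_boot all_order all_algebra.
From mathcomp Require Import all_classical all_reals all_analysis.
From mathcomp Require Import measurable_realfun ring lra.
Import Order.TTheory GRing.Theory Num.Theory.
Import numFieldNormedType.Exports.
Local Open Scope classical_set_scope.
Local Open Scope ring_scope.

(* Writing ln |y - c| as ln ((y - c)^2) / 2 gives one primitive of 1 / (y - c)
   valid on both sides of c. *)
Definition ln_dist {R : realType} (c y : R) : R := ln ((y - c) ^+ 2) / 2.

Lemma is_derive_ln_dist {R : realType} {c y : R} : y != c ->
  is_derive y 1 (ln_dist c) (1 / (y - c)).
Proof.
move=> yc; have yc0 : y - c != 0 by rewrite subr_eq0.
have d1 : is_derive y 1 (fun z : R => (z - c) ^+ 2) (2 * (y - c)).
  by apply: is_derive_eq; rewrite /GRing.scale/=; ring.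
have p2 : 0 < (y - c) ^+ 2 by rewrite exprn_even_gt0.
have d2 := @is_derive1_comp R (@ln R) (fun z : R => (z - c) ^+ 2) y _ _
  (is_derive1_ln p2) d1.
have -> : ln_dist c = (2^-1 : R) \*: (@ln R \o (fun z : R => (z - c) ^+ 2)).
  by apply/funext => z; rewrite /ln_dist /= /GRing.scale/= mulrC.
by apply: is_derive_eq; rewrite /GRing.scale/=; field.
Qed.

Lemma within_continuous_inv_sub {R : realType} (c : R) (A : set R) : ~ A c ->
  {within A, continuous (fun y => 1 / (y - c))}.
Proof.
move=> Ac; apply: continuous_in_subspaceT => y /set_mem Ay.
have yc0 : y - c != 0 by rewrite subr_eq0; apply: contra_notN Ac => /eqP <-.
apply/differentiable_continuous; rewrite -derivable1_diffP.
by apply: derivableM => //; apply: derivableV.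
Qed.

(** Away from the pole the integrand is continuous on the compact [A], hence integrable there. [D]
    is the set integrated over, such as an open interval whose closure avoids [c]. *)
Lemma integrable_inv_sub {R : realType} (c : R) (A D : set R) :
  compact A -> ~ A c -> measurable D -> D `<=` A ->
  lebesgue_measure.-integrable D (EFin \o (fun y : R => 1 / (y - c))).
Proof.
move=> cA Ac mD DA.
have iA := continuous_compact_integrable cA (within_continuous_inv_sub _ _ Ac).
by apply: integrableS iA => //; exact: compact_measurable.
Qed.

Lemma Rintegral_inv_sub {R : realType} {c p q : R} : p < q ->
  ~ (p <= c <= q) ->
  \int[lebesgue_measure]_(y in `]p, q[) (1 / (y - c)) = ln_dist c q - ln_dist c p.
Proof.
move=> pq cpq.
have pqc : ~ [set` `[p, q]] c by rewrite /= in_itv.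
have yc y : p <= y <= q -> y != c by move=> ypq; apply: contra_notN cpq => /eqP <-.
(* The fundamental theorem of calculus is applied on [[p, q]]; adding the two endpoints changes
   nothing, as they are null. *)
rewrite /Rintegral -(@integral_itv_bndoo _ p q _ true false); last first.
  apply: (measurable_int lebesgue_measure).
  apply: integrable_inv_sub pqc _ _ => //; first exact: segment_compact.
  by apply: subset_itv; rewrite bnd_simp.
rewrite (@continuous_FTC2 _ (fun y => 1 / (y - c)) (ln_dist c)) //.
- exact: within_continuous_inv_sub.
- have dF y : p <= y <= q -> derivable (ln_dist c) y 1.
    by move=> /yc ?; have [] := @is_derive_ln_dist R c y _.
  have cF y : p <= y <= q -> {for y, continuous (ln_dist c)}.
    by move=> /dF /derivable1_diffP /differentiable_continuous.
  split.
  + by move=> y; rewrite in_itv/= => /andP[py yq]; apply: dF; rewrite !ltW.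
  + by apply: cvg_at_right_filter; apply: cF; rewrite lexx ltW.
  + by apply: cvg_at_left_filter; apply: cF; rewrite lexx ltW.
- move=> y; rewrite in_itv/= => /andP[py yq].
  rewrite derive1E; apply: derive_val; apply: is_derive_ln_dist.
  by apply: yc; rewrite !ltW.
Qed.

(** The removed window is symmetric about [c] and [ln_dist c] is even around [c], so the terms at
    [c - eps] and [c + eps] cancel and the value no longer depends on [eps]. *)
Lemma truncated_integral_inv_sub {R : realType} (a b c eps : R) :
  0 < eps -> eps < c - a -> eps < b - c ->
  truncated_integral (fun y => 1 / (y - c)) a b c eps
  = ln (b - c) - ln (c - a).
Proof.
move=> e0 ea eb; rewrite /truncated_integral.
have -> : [set y : R | a < y < b /\ eps < `|y - c|] =
          `]a, (c - eps)[ `|` `](c + eps), b[.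
  apply/seteqP; split => y /=; rewrite !in_itv/= lter_normr.
    by move=> [/andP[ay yb] /orP[?|?]]; [right|left]; lra.
  by case=> /andP[? ?]; split; [lra|apply/orP; right; lra|lra|apply/orP; left; lra].
have lc : ~ (a <= c <= c - eps) by lra.
have rc : ~ (c + eps <= c <= b) by lra.
rewrite Rintegral_setU//; last first.
- apply/disj_setPS => y /=; rewrite !in_itv/= => -[/andP[? ?] /andP[? ?]]; lra.
- apply: (@integrable_inv_sub _ _ (`[a, (c - eps)] `|` `[(c + eps), b])).
  + by apply: compactU; exact: segment_compact.
  + by case; rewrite /= in_itv.
  + exact: measurableU.
  + by apply: setUSS; apply: subset_itv; rewrite bnd_simp.
rewrite !Rintegral_inv_sub//; [|lra..].
have -> : ln_dist c (c - eps) = ln_dist c (c + eps).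
  by rewrite /ln_dist; congr (ln _ / 2); ring.
(* [a - c] is negative, so its sign is flipped under the square before the exponent leaves the
   logarithm. *)
rewrite /ln_dist -(sqrrN (a - c)) opprB !lnXn; [|lra..].
by field.
Qed.

Lemma cvg_truncated_integral_inv_sub {R : realType} {a b c : R} :
  a < c -> c < b ->
  truncated_integral (fun y => 1 / (y - c)) a b c eps @[eps --> 0^'+]
    --> ln (b - c) - ln (c - a).
Proof.
move=> ac cb; apply: cvg_near_cst; near=> eps.
apply: truncated_integral_inv_sub; near: eps.
- exact: nbhs_right_gt.
- by apply: nbhs_right_lt; rewrite subr_gt0.
- by apply: nbhs_right_lt; rewrite subr_gt0.
Unshelve. all: by end_near. Qed.

(** The middle term [D u] vanishes at 0 and has derivative 1/(1+v) + 1/(1-v) - 2 = [D' v]. The mean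
    value theorem gives [D u = D' v * u] with 0 < v < u, and [D'] is nonnegative and increasing on
    [0, 1). *)
Lemma ln_ratio_bounds {R : realType} {u : R} : 0 < u -> u < 1 ->
  0 <= ln (1 + u) - ln (1 - u) - 2 * u <= 2 * u ^+ 3 / (1 - u ^+ 2).
Proof.
move=> u0 u1.
pose D (v : R) : R := ln (1 + v) - ln (1 - v) - 2 * v.
pose D' (v : R) : R := 2 * v ^+ 2 / (1 - v ^+ 2).
have dD v : 0 <= v <= u -> is_derive v 1 D (D' v).
  move=> vu.
  have vp : 0 < 1 + v by lra.
  have vm : 0 < 1 - v by lra.
  have d1 : is_derive v 1 (fun z : R => 1 + z) 1.
    by apply: is_derive_eq; ring.
  have d2 : is_derive v 1 (fun z : R => 1 - z) (-1).
    by apply: is_derive_eq; ring.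
  have l1 := @is_derive1_comp R (@ln R) (fun z : R => 1 + z) v _ _
    (is_derive1_ln vp) d1.
  have l2 := @is_derive1_comp R (@ln R) (fun z : R => 1 - z) v _ _
    (is_derive1_ln vm) d2.
  have l3 : is_derive v 1 (fun z : R => 2 * z) 2.
    by apply: is_derive_eq; rewrite /GRing.scale/=; ring.
  have -> : D = (@ln R \o (fun z : R => 1 + z)) - (@ln R \o (fun z : R => 1 - z))
                 - (fun z : R => 2 * z) by apply/funext.
  apply: is_derive_eq; rewrite /D'; field.
  by apply/and3P; split; [nra|lra|lra].
have [| |v] := @MVT _ D D' 0 u u0.
- by move=> v; rewrite in_itv/= => ?; apply: dD; lra.
- apply: derivable_within_continuous => v; rewrite in_itv/= => /dD.
  by case.
rewrite in_itv/= => /andP[v0 vu].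
have -> : D 0 = 0 by rewrite /D mulr0 addr0 !subr0 subrr.
rewrite !subr0 -/(D u) => ->.
have u2 : 0 < 1 - u ^+ 2 by nra.
have v2 : 0 < 1 - v ^+ 2 by nra.
apply/andP; split.
  by apply: mulr_ge0; [apply: divr_ge0; nra|lra].
have -> : 2 * u ^+ 3 / (1 - u ^+ 2) = 2 * u ^+ 2 / (1 - u ^+ 2) * u by ring.
rewrite ler_pM2r// /D' ler_pdivrMr// mulrAC ler_pdivlMr//.
nra.
Qed.

(** The sequence g of the overview: [harmonic k] is 1/(k+1), so [series harmonic n] is H_n. *)
Definition ln_harmonic_gap {R : realType} (n : nat) : R :=
  ln (n%:R + 1 / 2) - series harmonic n.

(** For u = 1/(2(n+1)) one has (1+u)/(1-u) = (n+3/2)/(n+1/2) and 2u = 1/(n+1), so the increment is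
    the quantity of [ln_ratio_bounds]. *)
Lemma ln_harmonic_gap_step {R : realType} (n : nat) :
  0 <= (ln_harmonic_gap n.+1 - ln_harmonic_gap n : R)
    <= 1 / 8 * (1 / (n%:R + 1 / 2) ^+ 2 - 1 / (n.+1%:R + 1 / 2) ^+ 2).
Proof.
have n0 : 0 <= n%:R :> R by [].
have -> : ln_harmonic_gap n.+1 - ln_harmonic_gap n =
    ln (n%:R + 1 + 1 / 2) - ln (n%:R + 1 / 2) - (n%:R + 1)^-1 :> R.
  by rewrite /ln_harmonic_gap seriesSr /= natr1; ring.
rewrite -[n.+1%:R]natr1; move: (n%:R : R) n0 => x x0.
pose u := 1 / (2 * (x + 1)).
have u0 : 0 < u by rewrite divr_gt0//; lra.
have uE : u * (x + 1) = 1 / 2 by rewrite /u; field; lra.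
have u1 : u < 1 by nra.
have /andP[lo hi] := ln_ratio_bounds u0 u1.
have E : ln (x + 1 + 1 / 2) - ln (x + 1 / 2) - (x + 1)^-1
         = ln (1 + u) - ln (1 - u) - 2 * u.
  have -> : 2 * u = (x + 1)^-1 by rewrite /u; field; lra.
  rewrite -!ln_div ?posrE; [|lra..].
  congr (ln _ - _); rewrite /u; field.
  by apply/andP; split; lra.
rewrite E lo/=; apply: (le_trans hi).
(* Since (x+1/2)(x+3/2) = (x+1)^2 (1-u^2), the telescoping bound exceeds [hi] exactly by a factor
   1/(1-u^2) > 1. *)
have -> : 1 / 8 * (1 / (x + 1 / 2) ^+ 2 - 1 / (x + 1 + 1 / 2) ^+ 2)
          = 2 * u ^+ 3 / (1 - u ^+ 2) ^+ 2.
  by rewrite /u; field; apply/and4P; split; nra.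
have u2 : 0 < 1 - u ^+ 2 by nra.
rewrite ler_pM2l; last by rewrite mulr_gt0// exprn_gt0.
rewrite lef_pV2 ?posrE ?exprn_gt0//.
by nra.
Qed.

Lemma ln_harmonic_gap_bounds {R : realType} (n k : nat) :
  0 <= (ln_harmonic_gap (n + k) - ln_harmonic_gap n : R)
    <= 1 / 8 * (1 / (n%:R + 1 / 2) ^+ 2 - 1 / ((n + k)%:R + 1 / 2) ^+ 2).
Proof.
elim: k => [|k ih]; first by rewrite addn0 !subrr mulr0 lexx.
rewrite addnS.
by have := @ln_harmonic_gap_step R (n + k); lra.
Qed.

(** Both sides are symmetric in [m] and [n]; for [n <= m] both absolute values drop. The two orders
    correspond to points left and right of the centre. *)
Lemma ln_harmonic_gap_dist {R : realType} (m n : nat) :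
  `|ln_harmonic_gap m - ln_harmonic_gap n : R| <=
    1 / 8 * `|1 / (n%:R + 1 / 2) ^+ 2 - 1 / (m%:R + 1 / 2) ^+ 2|.
Proof.
wlog nm : m n / (n <= m)%N.
  by move=> H; case: (leqP n m) => [/H//|/ltnW/H]; rewrite distrC (distrC (1 / _)).
rewrite -(subnKC nm); have /andP[lo hi] := @ln_harmonic_gap_bounds R n (m - n).
by rewrite !ger0_norm//; lra.
Qed.

Lemma midpointB {R : realType} (a h : R) (k j : nat) :
  midpoint a h k - midpoint a h j = (k%:R - j%:R) * h.
Proof. by rewrite /midpoint; ring. Qed.

(** The [m] midpoints to the right lie at distances h, ..., mh and contribute H_m; the [n] to the
    left contribute - H_n. *)
Lemma midpoint_sum {R : realType} (a h : R) (m n : nat) : h != 0 ->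
  \sum_(1 <= k < (n.+1 + m).+1 | k != n.+1)
     h / (midpoint a h k - midpoint a h n.+1)
  = series harmonic m - series harmonic n.
Proof.
move=> h0; under eq_bigr do rewrite midpointB.
rewrite (@big_cat_nat _ _ _ n.+1)//=; last exact: leqW (leq_addr _ _).
rewrite [X in _ + X]big_ltn_cond //; last by rewrite ltnS leq_addr.
rewrite eqxx /= addrC; congr (_ + _).
- rewrite -[n.+2]add0n big_addn (_ : (n.+1 + m).+1 - n.+2 = m)%N; last first.
    by rewrite -addSn addKn.
  rewrite /series /= big_mkcond; apply: eq_bigr => k _.
  rewrite gtn_eqF ?leq_addl// natrD /harmonic /=.
  have -> : k%:R + n.+2%:R - n.+1%:R = k.+1%:R :> R.
    by rewrite -[n.+2%:R]natr1 -[k.+1%:R]natr1; ring.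
  by rewrite invfM mulrCA divff// mulr1.
(* Reversal lists the left midpoints outwards, so that term [k] lies at distance (k+1)h. *)
- rewrite big_add1 /= /series /= big_nat_rev /= add0n -sumrN big_mkcond.
  apply: eq_big_nat => k /= kn.
  rewrite subnSK// ltn_eqF ?ltnS ?leq_subr//= natrB 1?ltnW//.
  have -> : n%:R - k%:R - n.+1%:R = - k.+1%:R :> R by rewrite -!natr1; ring.
  by rewrite invfM mulrCA divff// mulr1 invrN.
Qed.

Theorem lemma3p1 (R : realType) (a b h : R) (N M : nat)
    (hab : a < b) (hN : (0 < N)%N) (hM : (0 < M)%N)
    (hh : h = 1 / N%:R) (hba : b - a = M%:R * h) (j : nat)
    (hj : (1 <= j <= M)%N) :
  let x := midpoint a h in
  [/\ has_pv_integral (fun y => 1 / (y - x j)) a b (x j),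
      `|pv_error a b h M j| <=
        h ^+ 2 / 8 * `|1 / (x j - a) ^+ 2 - 1 / (b - x j) ^+ 2|
    & h ^+ 2 / 8 * `|1 / (x j - a) ^+ 2 - 1 / (b - x j) ^+ 2| =
        `|(a + b) / 2 - x j| * (b - a)
          * (h / (2 * (x j - a) * (b - x j))) ^+ 2].
Proof.
move=> x.
have h0 : 0 < h by rewrite hh divr_gt0 ?ltr0n.
(* [n] and [m] count the midpoints to the left and right of x_j. *)
case: j hj => // n /andP[_ nM]; pose m := (M - n.+1)%N.
have ME : M = (n.+1 + m)%N by rewrite subnKC.
have xa : x n.+1 - a = (n%:R + 1 / 2) * h.
  by rewrite /x /midpoint -[n.+1%:R]natr1; field.
have bx : b - x n.+1 = (m%:R + 1 / 2) * h.
  have -> : b - x n.+1 = (b - a) - (x n.+1 - a) by ring.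
  by rewrite hba xa ME natrD -[n.+1%:R]natr1; field.
have n0 : 0 < n%:R + 1 / 2 :> R by have : 0 <= n%:R :> R by []; lra.
have m0 : 0 < m%:R + 1 / 2 :> R by have : 0 <= m%:R :> R by []; lra.
have ax : a < x n.+1 by rewrite -subr_gt0 xa mulr_gt0.
have xb : x n.+1 < b by rewrite -subr_gt0 bx mulr_gt0.
have pv := cvg_truncated_integral_inv_sub ax xb.
split.
- by apply/cvg_ex; exists (ln (b - x n.+1) - ln (x n.+1 - a)).
(* The two copies of [ln h] from the endpoint distances cancel. *)
- have -> : pv_error a b h M n.+1 = ln_harmonic_gap m - ln_harmonic_gap n.
    rewrite /pv_error /pv_integral (cvg_lim _ pv)//.
    rewrite ME midpoint_sum ?gt_eqF// bx xa /ln_harmonic_gap !lnM ?posrE//.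
    by ring.
  apply: (le_trans (ln_harmonic_gap_dist _ _)).
  rewrite xa bx le_eqVlt; apply/orP; left; apply/eqP.
  rewrite !exprMn.
  have -> : 1 / ((n%:R + 1 / 2) ^+ 2 * h ^+ 2) - 1 / ((m%:R + 1 / 2) ^+ 2 * h ^+ 2)
     = (1 / (n%:R + 1 / 2) ^+ 2 - 1 / (m%:R + 1 / 2) ^+ 2) / h ^+ 2.
    by field; rewrite !gt_eqF.
  rewrite normrM [`|(h ^+ 2)^-1|]ger0_norm; last by rewrite invr_ge0 sqr_ge0.
  by field; rewrite gt_eqF.
- have A0 : 0 < x n.+1 - a by rewrite subr_gt0.
  have B0 : 0 < b - x n.+1 by rewrite subr_gt0.
  (* Difference of squares: (b-x) + (x-a) = b-a and (b-x) - (x-a) = a+b-2x. Only the latter can be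
     negative. *)
  have -> : 1 / (x n.+1 - a) ^+ 2 - 1 / (b - x n.+1) ^+ 2 =
     ((a + b) / 2 - x n.+1) *
      (2 * (b - a) / ((x n.+1 - a) * (b - x n.+1)) ^+ 2).
    by field; rewrite !gt_eqF.
  rewrite normrM [`|2 * _ / _|]ger0_norm; last first.
    by rewrite divr_ge0 ?sqr_ge0//; lra.
  by field; rewrite !gt_eqF.
Qed.
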